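(* Let $P(z)=\sum_{i=0}^{n}a_{i}z^{i}\in\mathbb{R}[z]$ be a nonzero real polynomial all of whose complex zeros $\zeta$ satisfy $2\pi/3<|\operatorname{Arg}\zeta|\le\pi$. Then for every integer $r$ with $0\le r<3$ such that the polynomial $$P_{r}(z)=\sum_{\substack{j\equiv r \pmod 3\\ 0\le j\le n}}a_{j}z^{j}$$ is not identically zero, every complex zero $z$ of $P_r$ lies on the $3$ radial rays given by $\operatorname{Im} z^{3}=0$ and $\operatorname{Re} z^{3}\le 0$.
   Context: $\operatorname{Arg}$ denotes the principal argument of a nonzero complex number, with $-\pi<\operatorname{Arg} z\le\pi$. The point $0$ has no argument, so it does not belong to the sector $2\pi/3<|\operatorname{Arg} z|\le\pi$. *)

(* Defs.v *)
From HB Require Import structures.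
From mathcomp Require Import all_boot all_order all_algebra.
From mathcomp Require Import all_classical all_reals all_analysis.
From mathcomp Require Import complex lra.

Set Implicit Arguments.
Unset Strict Implicit.
Unset Printing Implicit Defensive.

Import Order.TTheory GRing.Theory Num.Theory.
Import numFieldNormedType.Exports.

Local Open Scope ring_scope.
Local Open Scope complex_scope.

Definition modulus (R : realType) (z : R[i]) : R :=
  Num.sqrt (complex.Re z ^+ 2 + complex.Im z ^+ 2).

(* The principal argument, with values in ]-pi, pi]; the value at 0 carries no
   meaning.  [Arg_itv], [Arg_polar] and [Arg_unique] characterize it. *)
Definition Arg (R : realType) (z : R[i]) : R :=
  let t := acos (complex.Re z / modulus z) in
  if 0 <= complex.Im z then t else - t.

(* The part of [p] carried by the exponents congruent to [r] modulo [k]; the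
   exponents [j >= size p] are omitted since their coefficients vanish. *)
Definition residue_part (R : nzRingType) (k r : nat) (p : {poly R}) : {poly R} :=
  \sum_(j < size p | j == r %[mod k]) p`_j *: 'X^j.

Section ArgTheory.
Variable R : realType.
Implicit Types (z : R[i]) (t : R).

Lemma modulus_gt0 z : z != 0 -> 0 < modulus z.
Proof.
case: z => a b; rewrite eq_complex /= negb_and => nz.
rewrite /modulus sqrtr_gt0 /= lt_neqAle addr_ge0 ?sqr_ge0 // andbT eq_sym.
by rewrite paddr_eq0 ?sqr_ge0 // !sqrf_eq0 negb_and.
Qed.

Lemma modulus_sqr z :
  modulus z ^+ 2 = complex.Re z ^+ 2 + complex.Im z ^+ 2.
Proof. by rewrite sqr_sqrtr // addr_ge0 ?sqr_ge0. Qed.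

Lemma Re_div_modulus z : z != 0 -> -1 <= complex.Re z / modulus z <= 1.
Proof.
move=> /modulus_gt0 m0; rewrite -ler_norml normrM normfV (gtr0_norm m0).
rewrite ler_pdivrMr // mul1r -ler_sqr ?nnegrE ?(ltW m0) //.
by rewrite real_normK ?num_real // modulus_sqr lerDl sqr_ge0.
Qed.

Lemma Arg_itv z : z != 0 -> - pi < Arg z <= pi.
Proof.
move=> z0; have m0 := modulus_gt0 z0; have cz := Re_div_modulus z0.
have p0 := pi_gt0 R; have := acos_ge0 cz; have := acos_lepi cz.
rewrite /Arg /=; case: ifPn => [_|]; first by move=> *; apply/andP; split; lra.
rewrite -ltNge => b0 h1 h2.
have c1 : -1 < complex.Re z / modulus z.
  rewrite ltr_pdivlMr // mulN1r ltrNl.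
  have [a0|a0] := leP 0 (- complex.Re z); last exact: lt_trans m0.
  rewrite -ltr_sqr ?nnegrE ?(ltW m0) // sqrrN modulus_sqr ltrDl.
  by rewrite exprn_even_gt0 //= lt_eqF.
have : acos (complex.Re z / modulus z) < pi.
  by apply: acos_ltpi; rewrite c1; case/andP: cz.
by move=> h; apply/andP; split; lra.
Qed.

Lemma Arg_polar z : z != 0 ->
  z = (modulus z * cos (Arg z)) +i* (modulus z * sin (Arg z)).
Proof.
move=> z0; have m0 := modulus_gt0 z0; have cz := Re_div_modulus z0.
have mn0 : modulus z != 0 by rewrite gt_eqF.
have cE : cos (Arg z) = complex.Re z / modulus z.
  have -> : cos (Arg z) = cos (acos (complex.Re z / modulus z)).
    by rewrite /Arg; case: ifP => //; rewrite cosN.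
  by rewrite acosK // in_itv.
have sE : modulus z * sin (acos (complex.Re z / modulus z)) = `|complex.Im z|.
  rewrite sin_acos // -[X in X * _](ger0_norm (ltW m0)) -sqrtr_sqr.
  rewrite -sqrtrM ?sqr_ge0 // -sqrtr_sqr; congr Num.sqrt.
  by rewrite mulrBr mulr1 -exprMn mulrCA mulfV // mulr1 modulus_sqr addrC addKr.
rewrite cE mulrCA mulfV // mulr1 /Arg /=.
case: ifPn => [b0|]; first by rewrite sE ger0_norm //; case: (z).
by rewrite -ltNge => b0; rewrite sinN mulrN sE ltr0_norm // opprK; case: (z).
Qed.

Lemma Arg_unique z t : z != 0 -> - pi < t <= pi ->
  z = (modulus z * cos t) +i* (modulus z * sin t) -> t = Arg z.
Proof.
move=> z0 /andP[tl tu] zE; have m0 := modulus_gt0 z0.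
have mn0 : modulus z != 0 by rewrite gt_eqF.
have ReE : complex.Re z / modulus z = cos t.
  by rewrite [X in complex.Re X]zE /= mulrAC mulfV // mul1r.
have ImE : complex.Im z = modulus z * sin t by exact: (congr1 (@complex.Im R) zE).
rewrite /Arg /= ReE ImE pmulr_rge0 //; have p0 := pi_gt0 R.
have [t0|t0] := leP 0 t.
  by rewrite sin_ge0_pi ?t0 ?tu // cosK // in_itv /= t0.
have st : 0 < sin (- t) by apply: sin_gt0_pi; apply/andP; split; lra.
rewrite leNgt; move: st; rewrite sinN oppr_gt0 => -> /=.
by rewrite -cosN cosK ?opprK // in_itv /=; apply/andP; split; lra.
Qed.

End ArgTheory.

(* Main.v *)
Require Import Defs.
From mathcomp Require Import all_boot all_order all_algebra.
From mathcomp Require Import all_classical all_reals all_analysis.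
From mathcomp Require Import complex zify ring lra.

Set Implicit Arguments.
Unset Strict Implicit.
Unset Printing Implicit Defensive.

Import Order.TTheory GRing.Theory Num.Theory.
Import numFieldNormedType.Exports.

Local Open Scope ring_scope.
Local Open Scope complex_scope.

(** Write P(z) = A(x) + z B(x) + z^2 C(x) with x = z^3.  The nonzero zeros of
    P_r are cube roots of zeros of one of A, B, C, so it is enough to show that
    those of A, B, C that do not vanish identically only have zeros in
    ]-oo, 0].

    Since P is real, it is a constant times factors w z^2 + u z + v, one for
    each real zero (w = 0, u = 1) and one for each pair of conjugate zeros
    (w = 1).  The sector |Arg| > 2 pi / 3 says exactly that u, v > 0 and
    v w < u^2 for all these factors: for zeros rho e^(+-i theta) one has
    u = - 2 rho cos theta, v = rho^2, and v < u^2 means cos theta < - 1/2.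

    Number the sections t_0 = C, t_1 = B, t_2 = A and extend them to a sequence
    by t_(k+3) = x t_k.  Multiplication of P by w z^2 + u z + v replaces t_k by
    v t_k + u t_(k+1) + w t_(k+2), and v w <= u^2 is the condition that the
    band matrix with rows (v, u, w) have nonnegative 2 x 2 minors.  This
    suggests an interlacing invariant.  At a point x of the open upper half
    plane it reads: for s_k = t_k(x), the real numbers Im(s_(k+1) conj(s_k)) and
    Im(s_(k+2) conj(s_k)) are nonnegative.  The Cauchy-Binet expansion of the
    new cross products propagates it ([winding_smear]); as s_(k+3) = x s_k
    turns counterclockwise from s_k, the invariant also prevents the new values
    from vanishing unless the old ones do ([smear_eq0]).  By induction on the
    factors ([sectorial_ind]), no nonzero section vanishes off the real axis;
    positive zeros are excluded because all coefficients of the sections have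
    the same sign. *)

(** * Sequences turning counterclockwise *)

(** The signed area of the parallelogram on [z] and [y], that is,
    [Im (y * conj z)]. *)
Definition cross (R : realType) (y z : R[i]) : R :=
  complex.Im y * complex.Re z - complex.Re y * complex.Im z.

(** Interlacing, seen at one point [x]: consecutive terms turn counterclockwise,
    while three steps together amount to a single multiplication by [x].  The
    condition on steps of length two has to be carried along: it does not
    follow from the first when some terms vanish. *)
Definition winding (R : realType) (x : R[i]) (s : nat -> R[i]) : Prop :=
  [/\ forall k, s k.+3 = x * s k,
      forall k, 0 <= cross (s k.+1) (s k)
    & forall k, 0 <= cross (s k.+2) (s k)].

(** The effect on the sections of a polynomial of its multiplication by
    [w z ^ 2 + u z + v]. *)
Definition smear (A : nzRingType) (v u w : A) (s : nat -> A) (k : nat) : A :=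
  v * s k + u * s k.+1 + w * s k.+2.

Section Winding.
Variable R : realType.
Implicit Types (x y z : R[i]) (s : nat -> R[i]) (u v w : R).

Lemma ReM y z : complex.Re (y * z) =
  complex.Re y * complex.Re z - complex.Im y * complex.Im z.
Proof. by case: y z => [a b] [c d]. Qed.

Lemma ImM y z : complex.Im (y * z) =
  complex.Re y * complex.Im z + complex.Im y * complex.Re z.
Proof. by case: y z => [a b] [c d]. Qed.

Lemma Re_smear v u w s k : complex.Re (smear v%:C u%:C w%:C s k) =
  v * complex.Re (s k) + u * complex.Re (s k.+1) + w * complex.Re (s k.+2).
Proof.
rewrite /smear; case: (s k) (s k.+1) (s k.+2) => [a b] [c d] [e f] /=.
by rewrite !mul0r !subr0.
Qed.

Lemma Im_smear v u w s k : complex.Im (smear v%:C u%:C w%:C s k) =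
  v * complex.Im (s k) + u * complex.Im (s k.+1) + w * complex.Im (s k.+2).
Proof.
rewrite /smear; case: (s k) (s k.+1) (s k.+2) => [a b] [c d] [e f] /=.
by rewrite !mul0r !addr0.
Qed.

Definition smearE := (Re_smear, Im_smear).

Lemma cross_mul x y :
  cross (x * y) y = complex.Im x * (complex.Re y ^+ 2 + complex.Im y ^+ 2).
Proof. by rewrite /cross ReM ImM; ring. Qed.

Lemma cross_mul_ge0 x y : 0 < complex.Im x -> 0 <= cross (x * y) y.
Proof. by move=> x0; rewrite cross_mul (mulr_ge0 (ltW x0)) ?addr_ge0 ?sqr_ge0. Qed.

Lemma cross_mul_eq0 x y : 0 < complex.Im x -> cross (x * y) y <= 0 -> y = 0.
Proof.
move=> x0; rewrite cross_mul pmulr_rle0 // => h.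
have /eqP : complex.Re y ^+ 2 + complex.Im y ^+ 2 = 0.
  by apply/le_anti; rewrite h addr_ge0 ?sqr_ge0.
rewrite paddr_eq0 ?sqr_ge0 // !sqrf_eq0 => /andP[/eqP a0 /eqP b0].
by case: y {h} a0 b0 => [a b] /= -> ->.
Qed.

(** Both new cross products are expanded bilinearly.  The coefficients are
    2 x 2 minors of the band matrix with rows (v, u, w), and the only one not
    obviously nonnegative is [u ^ 2 - v * w].  For steps of length two,
    [cross (s k.+4) (s k)] may be negative; the terms that
    involve [x] then have to be grouped into a quadratic form in [s k] and
    [s k.+1], which is positive semidefinite for the same reason. *)
Lemma winding_smear x s u v w : 0 < complex.Im x ->
  0 < u -> 0 < v -> 0 <= w -> v * w <= u ^+ 2 ->
  winding x s -> winding x (smear v%:C u%:C w%:C s).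
Proof.
move=> x0 u0 v0 w0 vwu [s3 c1 c2].
have c3 k : 0 <= cross (s k.+3) (s k) by rewrite s3 cross_mul_ge0.
have d0 : 0 <= u ^+ 2 - v * w by rewrite subr_ge0.
have [u0' v0'] := (ltW u0, ltW v0).
split=> k; first by rewrite /smear !s3; ring.
  have -> : cross (smear v%:C u%:C w%:C s k.+1) (smear v%:C u%:C w%:C s k) =
     v ^+ 2 * cross (s k.+1) (s k) + (u ^+ 2 - v * w) * cross (s k.+2) (s k.+1)
     + u * v * cross (s k.+2) (s k) + v * w * cross (s k.+3) (s k)
     + u * w * cross (s k.+3) (s k.+1) + w ^+ 2 * cross (s k.+3) (s k.+2).
    by rewrite /cross !smearE; ring.
  by rewrite !addr_ge0 // mulr_ge0 ?c1 ?c2 ?c3 // ?sqr_ge0 // mulr_ge0.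
pose q := u * v * (complex.Re (s k) ^+ 2 + complex.Im (s k) ^+ 2)
  + u * w * (complex.Re (s k.+1) ^+ 2 + complex.Im (s k.+1) ^+ 2)
  + 2 * v * w * (complex.Re (s k) * complex.Re (s k.+1)
                 + complex.Im (s k) * complex.Im (s k.+1)).
have q0 : 0 <= q.
  (* Completing the square: u v q is the squared modulus of
     u v s_k + v w s_(k+1), plus a nonnegative multiple of |s_(k+1)|^2. *)
  rewrite -(pmulr_rge0 _ (mulr_gt0 u0 v0)).
  have -> : u * v * q =
      (u * v * complex.Re (s k) + v * w * complex.Re (s k.+1)) ^+ 2
      + (u * v * complex.Im (s k) + v * w * complex.Im (s k.+1)) ^+ 2
      + v * w * (u ^+ 2 - v * w)
        * (complex.Re (s k.+1) ^+ 2 + complex.Im (s k.+1) ^+ 2).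
    by rewrite /q; ring.
  rewrite !addr_ge0 ?sqr_ge0 // !mulr_ge0 // addr_ge0 ?sqr_ge0 //.
have -> : cross (smear v%:C u%:C w%:C s k.+2) (smear v%:C u%:C w%:C s k) =
   v ^+ 2 * cross (s k.+2) (s k) + u * v * cross (s k.+2) (s k.+1)
   + (u ^+ 2 - v * w) * cross (s k.+3) (s k.+1)
   + u * w * cross (s k.+3) (s k.+2) + w ^+ 2 * cross (s k.+4) (s k.+2)
   + complex.Im x * q.
  by rewrite /cross !smearE !s3 !ReM !ImM /q; ring.
by rewrite !addr_ge0 // mulr_ge0 ?c1 ?c2 ?c3 // ?sqr_ge0 ?(ltW x0) // mulr_ge0.
Qed.

(** A vanishing combination is detected by crossing it with [s k.+3 = x * s k]:
    all three contributions are nonnegative, so that of [s k] vanishes, which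
    forces [s k = 0] since [x] is not real.  Crossing with [s k.+4] then does
    the same for [s k.+1]. *)
Lemma smear_eq0 x s u v w k : 0 < complex.Im x ->
  0 < u -> 0 < v -> 0 <= w -> winding x s ->
  smear v%:C u%:C w%:C s k = 0 ->
  [/\ s k = 0, s k.+1 = 0 & w%:C * s k.+2 = 0].
Proof.
move=> x0 u0 v0 w0 [s3 c1 c2] s'0.
have c3 j : 0 <= cross (s j.+3) (s j) by rewrite s3 cross_mul_ge0.
have [re0 im0] := (congr1 (@complex.Re R) s'0, congr1 (@complex.Im R) s'0).
rewrite !smearE /= in re0 im0.
have E j : v * cross (s j) (s k) + u * cross (s j) (s k.+1)
           + w * cross (s j) (s k.+2) = 0.
  transitivity (complex.Im (s j) * 0 - complex.Re (s j) * 0); last by ring.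
  by rewrite -{1}re0 -im0 /cross; ring.
have sk0 : s k = 0.
  apply: (cross_mul_eq0 x0); rewrite -s3 -(pmulr_rle0 _ v0).
  have := E k.+3; have := mulr_ge0 (ltW u0) (c2 k.+1).
  by have := mulr_ge0 w0 (c1 k.+2); lra.
have sk1 : s k.+1 = 0.
  apply: (cross_mul_eq0 x0); rewrite -s3 -(pmulr_rle0 _ u0).
  have := E k.+4; have := mulr_ge0 w0 (c2 k.+2).
  by rewrite sk0 /cross /=; lra.
by split=> //; rewrite -s'0 /smear sk0 sk1 !mulr0 !add0r.
Qed.

End Winding.

(** * Real polynomials with zeros in the sector *)

Definition quad (R : nzRingType) (v u w : R) : {poly R} :=
  v%:P + u%:P * 'X + w%:P * 'X^2.

Local Notation eval p x := (map_poly (real_complex _) p).[x].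

(** The sector [2 pi / 3 <= |Arg x|] without the origin, in Cartesian
    coordinates. *)
Definition sectorial (R : realType) (P : {poly R}) : Prop :=
  forall x : R[i], eval P x = 0 ->
    complex.Re x < 0 /\ complex.Im x ^+ 2 <= 3 * complex.Re x ^+ 2.

Section Factor.
Variable R : realType.
Implicit Types (P Q : {poly R}) (a b u v w : R) (x : R[i]).

Lemma size_monic_quad v u : size (quad v u 1) = 3.
Proof.
rewrite /quad mul1r addrC size_polyDl size_polyXn // ltnS.
apply/leq_sizeP => -[|[|j]] //.
by rewrite coefD coefCM coefC coefX /= mulr0 addr0.
Qed.

Lemma eval_quad v u w x :
  eval (quad v u w) x = v%:C + u%:C * x + w%:C * x ^+ 2.
Proof.
rewrite /quad expr2 !rmorphD !rmorphM /= !map_polyC /= map_polyX.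
by rewrite !hornerE.
Qed.

Lemma quad_dvd P a b : b != 0 -> eval P (a +i* b) = 0 ->
  quad (a ^+ 2 + b ^+ 2) (- 2 * a) 1 %| P.
Proof.
set F := quad _ _ _ => b0 Px0.
have F0 : F != 0 by rewrite -size_poly_gt0 size_monic_quad.
have Fx0 : eval F (a +i* b) = 0.
  rewrite /F eval_quad; apply/eqP.
  by rewrite eq_complex /=; apply/andP; split; apply/eqP; ring.
have : (size (P %% F)%R < 3)%N.
  rewrite -[X in (_ < X)%N](size_monic_quad (a ^+ 2 + b ^+ 2) (- 2 * a)).
  by rewrite ltn_modp.
set Q := (P %% F)%R => sQ; apply/modp_eq0P; rewrite -/Q.
(* A real polynomial of degree at most 1 that vanishes at a nonreal point is
   zero. *)
have QE : Q = (Q`_0)%:P + (Q`_1)%:P * 'X.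
  apply/polyP => -[|[|j]]; rewrite coefD coefCM coefC coefX /=;
    rewrite ?mulr0 ?mulr1 ?addr0 ?add0r //.
  by rewrite nth_default // -ltnS (leq_trans sQ).
have Qx0 : eval Q (a +i* b) = 0.
  move: Px0; rewrite {1}(divp_eq P F) rmorphD rmorphM /= hornerD hornerM Fx0.
  by rewrite mulr0 add0r.
move: Qx0; rewrite {1}QE rmorphD rmorphM /= !map_polyC map_polyX !hornerE /= => E.
have /= /eqP := congr1 (@complex.Im R) E.
rewrite !mul0r !addr0 add0r mulf_eq0 (negPf b0) orbF => /eqP Q1.
have /= := congr1 (@complex.Re R) E.
rewrite Q1 !mul0r subr0 addr0 => Q0.
by rewrite QE Q0 Q1 polyC0 mul0r addr0.
Qed.

(** Splitting off one real zero or one pair of conjugate zeros at a time.  For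
    a pair [a +- i b] one has [u = - 2 a] and [v = a ^ 2 + b ^ 2], so that
    [v <= u ^ 2] is the inequality [b ^ 2 <= 3 a ^ 2] defining the sector. *)
Lemma sectorial_ind (K : {poly R} -> Prop) :
  (forall c, c != 0 -> K c%:P) ->
  (forall Q v u w, 0 < u -> 0 < v -> 0 <= w -> v * w <= u ^+ 2 ->
     K Q -> K (Q * quad v u w)) ->
  forall P, P != 0 -> sectorial P -> K P.
Proof.
move=> Kc Kq P; have [n] := ubnP (size P); elim: n P => // n IHn P sP P0 secP.
have [s1|s1] := eqVneq (size P) 1.
  have /size_poly1P[c c0 ->] : size P == 1 by rewrite s1.
  exact: Kc.
have Kfactor v u w : 0 < u -> 0 < v -> 0 <= w -> v * w <= u ^+ 2 ->
    (1 < size (quad v u w))%N -> quad v u w %| P -> K P.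
  move=> u0 v0 w0 vwu sF /dvdpP[Q PE].
  have Q0 : Q != 0 by apply: contraNneq P0 => Q0; rewrite PE Q0 mul0r.
  rewrite PE; apply: Kq => //; apply: IHn => //.
    have F0 : quad v u w != 0 by rewrite -size_poly_gt0 (ltn_trans _ sF).
    rewrite -ltnS (leq_trans _ sP) // ltnS PE size_mul //.
    by rewrite -subn1 -addnBA ?(ltnW sF) // -[X in (X < _)%N]addn0 ltn_add2l subn_gt0.
  by move=> x Qx0; apply: secP; rewrite PE rmorphM hornerM Qx0 mul0r.
have [[a b] /rootP Px0] : exists x, root (map_poly (real_complex R) P) x.
  by apply/closed_rootP; rewrite size_map_poly.
have [/= a0 ba] := secP _ Px0.
have [b0|b0] := eqVneq b 0; last first.
  have u0 : 0 < - 2 * a by clear Px0; lra.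
  have v0 : 0 < a ^+ 2 + b ^+ 2.
    by rewrite ltr_wpDr ?sqr_ge0 // exprn_even_gt0 //= lt_eqF.
  have vu : (a ^+ 2 + b ^+ 2) * 1 <= (- 2 * a) ^+ 2 by clear Px0; nra.
  apply: Kfactor u0 v0 ler01 vu _ _; first by rewrite size_monic_quad.
  exact: quad_dvd.
have quadE : quad (- a) 1 0 = 'X - a%:P.
  by rewrite /quad mul1r mul0r addr0 polyCN addrC.
apply: (Kfactor (- a) 1 0); rewrite ?quadE ?size_XsubC // ?oppr_gt0 //.
  by rewrite mulr0 sqr_ge0.
rewrite dvdp_XsubCl; apply/rootP/(fmorph_inj (real_complex R)).
by rewrite -horner_map rmorph0 -Px0 b0.
Qed.

End Factor.

(** * Sections modulo 3 *)

(** The polynomial whose sections are [t 2], [t 1], [t 0].  They are numbered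
    backwards so that multiplication by [z] shifts the sequence forwards. *)
Definition spread (R : nzRingType) (t : nat -> {poly R}) : {poly R} :=
  \sum_(d < 3) 'X^d * (t (2 - d)%N \Po 'X^3).

(** The invariant of the induction on the factors.  Nonnegative coefficients
    serve on the positive real axis, the rest on the upper half plane. *)
Definition tame (R : realType) (t : nat -> {poly R}) : Prop :=
  [/\ forall k, t k.+3 = 'X * t k,
      forall k i, 0 <= (t k)`_i
    & forall x : R[i], 0 < complex.Im x ->
        winding x (fun k => eval (t k) x) /\
        forall k, eval (t k) x = 0 -> t k = 0].

Section Sections.
Variable R : realType.
Implicit Types (P : {poly R}) (t : nat -> {poly R}) (u v w c : R) (x : R[i]).

Lemma coef_residue_part k r P i :
  (residue_part k r P)`_i = if i == r %[mod k] then P`_i else 0.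
Proof.
rewrite /residue_part coef_sumMXn.
have [iP|iP] := ltnP i (size P); last first.
  rewrite big_pred0 ?nth_default ?if_same // => j.
  by apply/negP => /andP[_ /eqP ji]; move: (ltn_ord j); rewrite ji ltnNge iP.
case: ifP => ir.
  rewrite (big_pred1 (Ordinal iP)) // => j.
  rewrite /pred1 /= -val_eqE /=.
  by case: (val j =P i) => [->|]; rewrite ?andbF // ir.
rewrite big_pred0 // => j.
by case: (val j =P i) => [->|]; rewrite ?andbF // ir.
Qed.

Lemma coef_section0 d (p : {poly R}) i :
  i != d %[mod 3] -> ('X^d * (p \Po 'X^3))`_i = 0.
Proof.
move=> id; rewrite coefXnM; case: ltnP => // di.
by rewrite coef_comp_poly_Xn // -eqn_mod_dvd // (negPf id).
Qed.

Lemma residue_part_spread r c t : (r < 3)%N ->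
  residue_part 3 r (c *: spread t) = c *: ('X^r * (t (2 - r)%N \Po 'X^3)).
Proof.
move=> r3; apply/polyP => i; rewrite coef_residue_part !coefZ.
case: ifPn => [ir|ir]; last by rewrite coef_section0 // mulr0.
rewrite coef_sum (bigD1 (Ordinal r3)) //= big1 ?addr0 // => d dr.
apply: coef_section0; rewrite (eqP ir) !modn_small // eq_sym.
by rewrite -val_eqE in dr.
Qed.

Lemma spread_smear v u w t : (forall k, t k.+3 = 'X * t k) ->
  spread (smear v%:P u%:P w%:P t) = spread t * quad v u w.
Proof.
move=> t3; rewrite /spread !big_ord_recl !big_ord0 /= /bump /= /smear !t3.
rewrite !(comp_polyD, comp_polyM, comp_polyC, comp_polyX) /quad.
by rewrite !expr0 !expr1; ring.
Qed.

Lemma tame_smear v u w t : 0 < u -> 0 < v -> 0 <= w -> v * w <= u ^+ 2 ->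
  tame t -> tame (smear v%:P u%:P w%:P t).
Proof.
move=> u0 v0 w0 vwu [t3 tnn tx]; split.
- by move=> k; rewrite /smear !t3; ring.
- move=> k i; rewrite /smear !coefD !coefCM.
  by rewrite !addr_ge0 // mulr_ge0 ?tnn //; exact: ltW.
move=> x x0; have [wind tz] := tx x x0.
have E k : eval (smear v%:P u%:P w%:P t k) x =
           smear v%:C u%:C w%:C (fun k => eval (t k) x) k.
  by rewrite /smear !rmorphD !rmorphM /= !map_polyC /= !hornerE.
split=> [|k].
  have -> : (fun k => eval (smear v%:P u%:P w%:P t k) x) =
            smear v%:C u%:C w%:C (fun k => eval (t k) x) by apply/funext.
  exact: winding_smear.
rewrite E => /(smear_eq0 x0 u0 v0 w0 wind)[/tz tk /tz tk1 /eqP].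
rewrite /smear tk tk1 !mulr0 !add0r mulf_eq0 => /orP[/eqP|/eqP/tz ->].
  by move=> /(fmorph_inj (real_complex R)) ->; rewrite polyC0 mul0r.
by rewrite mulr0.
Qed.

(** The sections of the constant 1, extended by [t k.+3 = 'X * t k]. *)
Definition sections1 (R : nzRingType) (k : nat) : {poly R} :=
  if (k %% 3 == 2)%N then 'X^(k %/ 3) else 0.

Lemma spread_sections1 : spread (sections1 R) = 1.
Proof.
rewrite /spread !big_ord_recl !big_ord0 /= /sections1 /=.
by rewrite !comp_poly0 !mulr0 !addr0 !expr0 mul1r comp_polyC.
Qed.

(** Two terms at distance one or two never have both indices congruent to 2
    modulo 3, so every cross product involves a zero term. *)
Lemma tame_sections1 : tame (sections1 R).
Proof.
have cross0 (x : R[i]) j k : ((j %% 3 == 2) && (k %% 3 == 2))%N = false ->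
    0 <= cross (eval (sections1 R j) x) (eval (sections1 R k) x).
  rewrite /sections1 /cross; case: eqP => _; case: eqP => _ //= _;
  by rewrite rmorph0 horner0 /= ?mulr0 ?mul0r subr0.
split.
- move=> k; rewrite /sections1 -addn3 modnDr divnDr // addn1 exprS.
  by case: ifP; rewrite ?mulr0.
- by move=> k i; rewrite /sections1; case: ifP; rewrite ?coef0 ?coefXn ?ler0n.
move=> x x0; split; last first.
  move=> k; rewrite /sections1; case: ifP => // _.
  rewrite map_polyXn hornerXn => /eqP; rewrite expf_eq0 => /andP[_ /eqP xz].
  by rewrite xz ltxx in x0.
split=> k; [|by apply: cross0; lia..].
rewrite /sections1 -addn3 modnDr divnDr // addn1 exprS.
case: ifP; rewrite ?rmorph0 ?horner0 ?mulr0 //.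
by rewrite rmorphM /= map_polyX hornerM hornerX.
Qed.

Lemma sectorial_spread P : P != 0 -> sectorial P ->
  exists c t, [/\ c != 0, tame t & P = c *: spread t].
Proof.
move=> P0 secP.
apply: (sectorial_ind (K := fun P => exists c t,
          [/\ c != 0, tame t & P = c *: spread t])) P0 secP => {P}.
  move=> c c0; exists c, (sections1 R); split=> //; first exact: tame_sections1.
  by rewrite spread_sections1 alg_polyC.
move=> Q v u w u0 v0 w0 vwu [c [t [c0 tt QE]]].
exists c, (smear v%:P u%:P w%:P t); split=> //; first exact: tame_smear.
by case: tt => t3 _ _; rewrite spread_smear // QE scalerAl.
Qed.

Lemma nneg_poly_neq0 (p : {poly R}) (x : R) :
  (forall i, 0 <= p`_i) -> p != 0 -> 0 < x -> p.[x] != 0.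
Proof.
move=> pnn p0 x0; apply: contraNneq p0 => px.
have nn (i : 'I_(size p)) : true -> 0 <= p`_i * x ^+ i.
  by move=> _; rewrite mulr_ge0 ?exprn_ge0 ?(ltW x0).
have := psumr_eq0P nn; rewrite -horner_coef => /(_ px) z.
apply/eqP/polyP => i; rewrite coef0.
have [ip|ip] := ltnP i (size p); last by rewrite nth_default.
have /eqP := z (Ordinal ip) isT.
by rewrite mulf_eq0 expf_eq0 (gt_eqF x0) andbF orbF => /eqP.
Qed.

Lemma eval_conj (p : {poly R}) x : eval p x^*%C = (eval p x)^*%C.
Proof.
rewrite -horner_map; congr (_.[_]); apply/polyP => i.
by rewrite !coef_map /= oppr0.
Qed.

(** Zeros in the lower half plane are conjugate to zeros in the upper one. *)
Lemma tame_root t k x : tame t -> t k != 0 -> eval (t k) x = 0 ->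
  complex.Im x = 0 /\ complex.Re x <= 0.
Proof.
move=> [_ tnn tx] tk0 tkx.
have x0 : complex.Im x = 0.
  apply/eqP; case: ltgtP => // x0; case/eqP: tk0.
    apply: (tx x^*%C _).2; first by case: (x) x0 => a b; rewrite /= oppr_gt0.
    by rewrite eval_conj tkx rmorph0.
  exact: (tx x x0).2.
split=> //; rewrite leNgt; apply/negP => Rx0.
have /eqP := nneg_poly_neq0 (tnn k) tk0 Rx0; apply.
apply: (fmorph_inj (real_complex R)); rewrite -horner_map rmorph0 -tkx.
by case: x x0 {tkx Rx0} => a b /= ->.
Qed.

End Sections.

(** * The sector in polar coordinates *)

Section Angle.
Variable R : realType.

(** With [c = cos (pi / 3)], the double angle formula and the symmetry about
    [pi / 2] give [2 c ^ 2 - 1 = - c]. *)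
Lemma cos_2pi3 : cos (2%:R * pi / 3%:R) = - (1 / 2) :> R.
Proof.
have p0 := pi_gt0 R; set c := cos (pi / 3%:R) : R.
have c0 : 0 < c by apply: cos_gt0_pihalf; apply/andP; split; lra.
have e1 : cos (2%:R * pi / 3%:R) = c ^+ 2 *+ 2 - 1 :> R.
  by rewrite -cos_mulr2n; congr cos; lra.
have e2 : cos (2%:R * pi / 3%:R) = - c :> R.
  have -> : 2%:R * pi / 3%:R = - (pi / 3%:R) + pi :> R by lra.
  by rewrite cosDpi cosN.
have : (2 * c - 1) * (c + 1) = 0 by move: e1; rewrite e2 mulr2n; nra.
move/eqP; rewrite mulf_eq0 => /orP[] /eqP h; lra.
Qed.

Lemma sector_Arg (x : R[i]) : x != 0 ->
  2%:R * pi / 3%:R < `|Arg x| <= pi ->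
  complex.Re x < 0 /\ complex.Im x ^+ 2 <= 3 * complex.Re x ^+ 2.
Proof.
move=> x0 /andP[lo hi]; have p0 := pi_gt0 R; have m0 := modulus_gt0 x0.
have cos_lt : cos (Arg x) < - (1 / 2).
  have -> : cos (Arg x) = cos `|Arg x|.
    by case: (ger0P (Arg x)) => //; rewrite cosN.
  by rewrite -cos_2pi3 ltr_cos // in_itv /=; apply/andP; split; lra.
have ReE : complex.Re x = modulus x * cos (Arg x).
  by rewrite {1}(Arg_polar x0).
have a_lt : complex.Re x < - (modulus x / 2).
  rewrite ReE -mulrN ltr_pM2l //; lra.
have mE := modulus_sqr x.
by split; [lra | nra].
Qed.

End Angle.

(** * Zeros of the sections *)

Theorem theorem1 (R : realType) (P : {poly R}) (hP : P != 0)
  (hzeros : forall zeta : R[i],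
     root (map_poly (real_complex R) P) zeta ->
     zeta != 0 /\ 2%:R * pi / 3%:R < `|Arg zeta| <= pi)
  (r : nat) (hr : (r < 3)%N)
  (hPr : residue_part 3 r P != 0)
  (z : R[i]) (hz : root (map_poly (real_complex R) (residue_part 3 r P)) z) :
  complex.Im (z ^+ 3) = 0 /\ complex.Re (z ^+ 3) <= 0.
Proof.
have secP : sectorial P.
  by move=> x /rootP /hzeros[x0 xArg]; apply: sector_Arg.
have [c [t [c0 tt PE]]] := sectorial_spread hP secP.
(* The factor z^r contributes the zero z = 0, where z^3 = 0 satisfies the
   conclusion. *)
have [->|z0] := eqVneq z 0; first by rewrite expr0n.
move: hPr hz; rewrite PE residue_part_spread //.
set s := t _ => sE /rootP.
have s0 : s != 0.
  by apply: contraNneq sE => ->; rewrite comp_poly0 mulr0 scaler0.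
rewrite -mul_polyC !rmorphM /= map_polyC map_polyXn /= map_comp_poly map_polyXn.
rewrite !hornerE horner_comp hornerXn => /eqP.
rewrite !mulf_eq0 fmorph_eq0 (negPf c0) expf_eq0 (negPf z0) andbF /= => /eqP.
exact: tame_root tt s0.
Qed.
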